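(* Let $G$ and $H$ be E-graphs over a signature $\Sigma$. There exists at most one homomorphism $h:G\to H$.
   Context: A signature $\Sigma$ is a finite set of function symbols with arities; $T(\Sigma)$ is the set of ground terms. A (bottom-up) tree automaton $\mathcal A=\langle Q,\Sigma,\Delta\rangle$ (no final states) has a possibly infinite set $Q$ of states and a possibly infinite set $\Delta$ of transitions $f(q_1,\dots,q_n)\to q$ with $f\in\Sigma$ of arity $n$ and $q_i,q\in Q$. Viewing states as nullary symbols, $\to^*_{\mathcal A}$ is the reflexive-transitive closure of rewriting by $\Delta$. $\mathcal A$ is deterministic if $t\to^*_{\mathcal A}q_1$ and $t\to^*_{\mathcal A}q_2$ (with $t\in T(\Sigma)$, $q_1,q_2\in Q$) imply $q_1=q_2$; it is reachable if for every $q\in Q$ there is $t\in T(\Sigma)$ with $t\to^*_{\mathcal A}q$. An E-graph is a deterministic and reachable tree automaton (possibly infinite). A homomorphism $h:G\to H$ is a map of states such that for every transition $f(c_1,\dots,c_k)\to c$ of $G$, $f(h(c_1),\dots,h(c_k))\to h(c)$ is a transition of $H$. *)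

(* Defs.v *)
From Stdlib Require Import Relation_Operators.
From mathcomp Require Import all_boot.

Set Implicit Arguments.
Unset Strict Implicit.
Unset Printing Implicit Defensive.

Record signature := Signature { symbol :> finType; arity : symbol -> nat }.

(* Terms over S with the elements of X adjoined as extra nullary symbols. *)
Inductive term (S : signature) (X : Type) : Type :=
| Leaf (x : X)
| App (f : S) (args : {ffun 'I_(arity f) -> term S X}).
Arguments Leaf {S X} x.
Arguments App {S X} f args.

Fixpoint map_term (S : signature) (X Y : Type) (g : X -> Y) (t : term S X) :
    term S Y :=
  match t with
  | Leaf x => Leaf (g x)
  | App f args => App f [ffun i => map_term g (args i)]
  end.

Definition ground_term (S : signature) : Type := term S void.

Definition of_ground (S : signature) (X : Type) (t : ground_term S) : term S X :=
  map_term (of_void X) t.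
Arguments of_ground {S} X t.

(* [transition A f qs q] means that f(qs 0, ..., qs (n-1)) -> q is a
   transition of A. *)
Record automaton (S : signature) := Automaton {
  state : Type;
  transition : forall f : S, {ffun 'I_(arity f) -> state} -> state -> Prop
}.
Arguments transition {S} a f qs q.

Inductive rewrite_step (S : signature) (A : automaton S) :
    term S (state A) -> term S (state A) -> Prop :=
| rewrite_root (f : S) (qs : {ffun 'I_(arity f) -> state A}) (q : state A) :
    transition A f qs q ->
    rewrite_step (App f [ffun i => Leaf (qs i)]) (Leaf q)
| rewrite_arg (f : S) (args : {ffun 'I_(arity f) -> term S (state A)})
    (i : 'I_(arity f)) (u : term S (state A)) :
    rewrite_step (args i) u ->
    rewrite_step (App f args)
                 (App f [ffun j => if j == i then u else args j]).

Definition rewrites (S : signature) (A : automaton S) :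
    term S (state A) -> term S (state A) -> Prop :=
  clos_refl_trans _ (@rewrite_step S A).

Definition evaluates_to (S : signature) (A : automaton S)
    (t : ground_term S) (q : state A) : Prop :=
  rewrites (of_ground (state A) t) (Leaf q).

Definition deterministic (S : signature) (A : automaton S) : Prop :=
  forall (t : ground_term S) (q1 q2 : state A),
    evaluates_to t q1 -> evaluates_to t q2 -> q1 = q2.

Definition reachable (S : signature) (A : automaton S) : Prop :=
  forall q : state A, exists t : ground_term S, evaluates_to t q.

Record egraph (S : signature) := EGraph {
  egraph_automaton :> automaton S;
  egraph_deterministic : deterministic egraph_automaton;
  egraph_reachable : reachable egraph_automaton
}.

Definition homomorphism (S : signature) (A B : automaton S)
    (h : state A -> state B) : Prop :=
  forall (f : S) (cs : {ffun 'I_(arity f) -> state A}) (c : state A),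
    transition A f cs c -> transition B f [ffun i => h (cs i)] (h c).
Arguments homomorphism {S} A B h.

(* Main.v *)
Require Import Defs.
From Stdlib Require Import FunctionalExtensionality Relation_Operators.
From mathcomp Require Import all_boot.

Set Implicit Arguments.
Unset Strict Implicit.
Unset Printing Implicit Defensive.

(** A homomorphism [h], applied at the leaves of terms, carries rewriting in
    [G] to rewriting in [H] and fixes ground terms, so if a ground term [t]
    evaluates to [c] in [G] it evaluates to [h c] in [H].  Every state [c] is
    the value of some [t], and the value of [t] in [H] is unique, so [h c] does
    not depend on [h]. *)

Lemma map_term_of_ground (S : signature) (X Y : Type) (g : X -> Y)
    (t : ground_term S) :
  map_term g (of_ground X t) = of_ground Y t.
Proof.
(* Subterms sit inside a finite function, so the recursion on them is set up by hand; the leaf case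
   is empty because ground terms have leaves in [void]. *)
move: t; fix IH 1 => -[[]|f args].
congr App; apply/ffunP => i.
by rewrite !ffunE; apply: IH.
Qed.

Section Homomorphism.

Variables (S : signature) (A B : automaton S) (h : state A -> state B).
Hypothesis hom_h : homomorphism A B h.

Lemma rewrite_step_map_term (t u : term S (state A)) :
  rewrite_step t u -> rewrite_step (map_term h t) (map_term h u).
Proof.
elim=> {t u} [f qs q Aq|f args i u _ IH] /=.
  (* The mapped redex is again a symbol applied to state leaves, the form [rewrite_root] asks
     for. *)
  have -> : [ffun i => map_term h ([ffun j => Leaf (qs j)] i)]
          = [ffun i => Leaf ([ffun j => h (qs j)] i)] :> {ffun _ -> term S _}.
    by apply/ffunP => i; rewrite !ffunE.
  exact/rewrite_root/hom_h.
(* Mapping commutes with replacing the [i]-th argument, so the mapped step is again a step at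
   position [i]. *)
have -> : [ffun j => map_term h ([ffun k => if k == i then u else args k] j)]
        = [ffun j => if j == i then map_term h u
                     else [ffun k => map_term h (args k)] j].
  by apply/ffunP => j; rewrite !ffunE; case: eqP.
by apply: rewrite_arg; rewrite ffunE.
Qed.

Lemma rewrites_map_term (t u : term S (state A)) :
  rewrites t u -> rewrites (map_term h t) (map_term h u).
Proof.
elim=> {t u} [t u tu|t|t u v _ tu _ uv].
- exact/rt_step/rewrite_step_map_term.
- exact: rt_refl.
- exact: rt_trans tu uv.
Qed.

Lemma evaluates_to_homomorphism (t : ground_term S) (q : state A) :
  evaluates_to t q -> evaluates_to t (h q).
Proof. by move/rewrites_map_term; rewrite map_term_of_ground. Qed.

End Homomorphism.

Theorem lemma11 (S : signature) (G H : egraph S)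
    (h1 h2 : state G -> state H) :
  homomorphism G H h1 -> homomorphism G H h2 -> h1 = h2.
Proof.
move=> hom1 hom2; apply: functional_extensionality => c.
have [t tc] := egraph_reachable c.
by apply: (@egraph_deterministic _ H t); apply: evaluates_to_homomorphism.
Qed.
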